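(* Let $C \subseteq \mathbb{R}^n$ be an approximately M-decomposable set. Then $C$ is hyperbolic.
   Context: $B$ denotes the closed Euclidean unit ball of $\mathbb{R}^n$ and $M+P$ the Minkowski sum of sets. For a nonempty closed convex set $C \subseteq \mathbb{R}^n$: - the recession cone is $0^{+}C = \{d \in \mathbb{R}^n : x + \mu d \in C \text{ for all } x \in C,\ \mu \geq 0\}$; - for $r > 0$ the truncation of $C$ of radius $r$ is $C_r = (C \cap rB) + 0^{+}C$ (empty if $C \cap rB$ is empty); - $C$ is called approximately M-decomposable if for every $\varepsilon > 0$ there exists $r > 0$ such that $C \subseteq C_r + \varepsilon B$; - $C$ is called hyperbolic if there exists a compact convex set $M \subseteq \mathbb{R}^n$ such that $C \subseteq M + 0^{+}C$. Both notions (approximately M-decomposable, hyperbolic) include by definition that $C$ is nonempty, closed and convex. *)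

(* Defs.v *)
From mathcomp Require Import all_boot all_order all_algebra.
From mathcomp Require Import all_classical all_reals all_analysis.
Import Order.TTheory GRing.Theory Num.Theory.
Import numFieldNormedType.Exports.

Set Implicit Arguments.
Unset Strict Implicit.
Unset Printing Implicit Defensive.

Local Open Scope classical_set_scope.
Local Open Scope ring_scope.

(* The canonical norm `|x| on 'rV[R]_n is the sup norm; the balls below are
   Euclidean, hence this separate norm. The canonical topology of 'rV[R]_n
   (used for closed and compact) is the usual one of R^n. *)
Definition enorm (R : realType) (n : nat) (x : 'rV[R]_n) : R :=
  Num.sqrt (\sum_(i < n) x ord0 i ^+ 2).

Definition eunit_ball (R : realType) (n : nat) : set 'rV[R]_n :=
  [set x | enorm x <= 1].
Arguments eunit_ball {R n}.

Definition dilate (R : realType) (n : nat) (r : R) (A : set 'rV[R]_n) :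
    set 'rV[R]_n :=
  [set r *: x | x in A].

Definition minkowski_sum (R : realType) (n : nat) (A P : set 'rV[R]_n) :
    set 'rV[R]_n :=
  [set x + y | x in A & y in P].

Definition convex (R : realType) (n : nat) (C : set 'rV[R]_n) : Prop :=
  convex_set (C : set (convex_lmodType 'rV[R]_n)).

Definition nonempty_closed_convex (R : realType) (n : nat)
    (C : set 'rV[R]_n) : Prop :=
  [/\ C !=set0, closed C & convex C].

Definition recession_cone (R : realType) (n : nat) (C : set 'rV[R]_n) :
    set 'rV[R]_n :=
  [set d | forall x, C x -> forall mu : R, 0 <= mu -> C (x + mu *: d)].

Definition truncation (R : realType) (n : nat) (C : set 'rV[R]_n) (r : R) :
    set 'rV[R]_n :=
  minkowski_sum (C `&` dilate r eunit_ball) (recession_cone C).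

Definition approx_M_decomposable (R : realType) (n : nat)
    (C : set 'rV[R]_n) : Prop :=
  nonempty_closed_convex C /\
  forall eps : R, 0 < eps -> exists2 r : R, 0 < r &
    C `<=` minkowski_sum (truncation C r) (dilate eps eunit_ball).

Definition hyperbolic (R : realType) (n : nat) (C : set 'rV[R]_n) : Prop :=
  nonempty_closed_convex C /\
  exists M : set 'rV[R]_n,
    [/\ compact M, convex M & C `<=` minkowski_sum M (recession_cone C)].

(* Main.v *)
(** The case [eps = 1] already suffices: it gives [r > 0] such that
    [C] is contained in [r B + 0^+ C + B], hence in [M + 0^+ C] for any compact
    convex [M] containing [(r + 1) B]. The cube of half-side [r + 1] is such an [M]. *)
Require Import Defs.
From mathcomp Require Import all_boot all_order all_algebra.
From mathcomp Require Import all_classical all_reals all_analysis.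
From mathcomp Require Import lra.
Import Order.TTheory GRing.Theory Num.Theory.
Import numFieldNormedType.Exports.

Set Implicit Arguments.
Unset Strict Implicit.
Unset Printing Implicit Defensive.

Local Open Scope classical_set_scope.
Local Open Scope ring_scope.

(** With a cube in place of a Euclidean ball, compactness is that of a product of segments and
    convexity is checked coordinatewise. *)
Definition cube (R : realType) (n : nat) (K : R) : set 'rV[R]_n :=
  [set v | forall i, `[- K, K]%classic (v ord0 i)].

Lemma compact_cube (R : realType) (n : nat) (K : R) : compact (@cube R n K).
Proof.
apply: (@rV_compact R n (fun=> `[- K, K]%classic)) => _.
exact: segment_compact.
Qed.

Lemma convex_cube (R : realType) (n : nat) (K : R) : convex (@cube R n K).
Proof.
move=> x y l /set_mem Mx /set_mem My; apply/mem_set => i.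
have l0 : 0 <= l%:num by [].
have l1 : l%:num <= 1 by [].
have := Mx i; have := My i.
rewrite /= !in_itv /= !mxE => /andP[y1 y2] /andP[x1 x2].
rewrite /unstable.onem; apply/andP; split; nra.
Qed.

(** One squared coordinate is at most the whole sum of squares; this is how Euclidean balls fit into
    cubes. *)
Lemma dilate_ball_coord (R : realType) (n : nat) (r : R) (x : 'rV[R]_n)
  (i : 'I_n) : 0 <= r -> dilate r eunit_ball x -> `|x ord0 i| <= r.
Proof.
move=> r0 [u u1 <-]; rewrite mxE normrM (ger0_norm r0) -[leRHS]mulr1.
apply: ler_wpM2l => //; apply: le_trans u1.
rewrite -sqrtr_sqr ler_wsqrtr// (bigD1 i)//= lerDl.
by apply: sumr_ge0 => j _; exact: sqr_ge0.
Qed.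

Theorem proposition3p5 (R : realType) (n : nat) (C : set 'rV[R]_n)
  (hC : approx_M_decomposable C) : hyperbolic C.
Proof.
have [ncC /(_ 1 ltr01)[r r0 sub]] := hC.
split => //; exists (cube (r + 1)).
split; [exact: compact_cube | exact: convex_cube | move=> c Cc].
have [_ [x [_ xr] [d dC <-]] [b b1 <-]] := sub _ Cc.
(* Here [c] is [(x + d) + b]: moving the bounded error [b] next to [x] leaves the recession
   direction [d] as second summand. *)
exists (x + b); last by exists d => //; rewrite addrAC.
move=> i; rewrite /= in_itv /= -ler_norml mxE.
apply: le_trans (ler_normD _ _) _.
(* The coordinate bounds [r] for [x] and [1] for [b] add up to the half-side. *)
by apply: lerD; apply: dilate_ball_coord => //; exact: ltW.
Qed.
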